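(* There is an absolute constant $c>0$ such that the following holds. Let $\alpha\in[0,1)$ be irrational, let $M$ be a positive integer, and let $k$ be such that $q_k\le M<q_{k+1}$, where $p_j/q_j$ denotes the $j$-th convergent of $\alpha$. Then $$S_M(\alpha)=\sum_{m=1}^M\frac1{\|m\alpha\|}\ \ge\ c\,M\log q_k.$$
   Context: For real $x$, $\|x\|=\min_{n\in\mathbf Z}|x-n|$. For $\alpha\in[0,1)$ irrational, write $\alpha=[a_1,a_2,\dots]=\cfrac{1}{a_1+\cfrac{1}{a_2+\cdots}}$ with positive integers $a_i$; the $j$-th convergent is $p_j/q_j=[a_1,\dots,a_j]$ in lowest terms, with $q_0=1$, $q_1=a_1$, $q_j=a_jq_{j-1}+q_{j-2}$ for $j\ge2$. *)

(* Defs.v *)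
From HB Require Import structures.
From mathcomp Require Import all_boot all_order all_algebra.
From mathcomp Require Import all_classical all_reals all_analysis.
From mathcomp Require Import ring lra zify.

Set Implicit Arguments.
Unset Strict Implicit.
Unset Printing Implicit Defensive.

Import Order.TTheory GRing.Theory Num.Theory.
Import numFieldNormedType.Exports.

Local Open Scope classical_set_scope.
Local Open Scope ring_scope.

(* The infimum is attained, see [dist_intP], so this is the minimum. *)
Definition dist_int (R : realType) (x : R) : R :=
  inf (range (fun n : int => `|x - n%:~R|)).

(* [contfrac [:: a_1; ...; a_j]] = 1 / (a_1 + 1 / (... + 1 / a_j)), and 0 on
   the empty sequence. *)
Fixpoint contfrac (R : realType) (s : seq nat) : R :=
  if s is a :: s' then (a%:R + contfrac R s')^-1 else 0.

(* Sequences of partial quotients a_1, a_2, ... are indexed from 1; the value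
   [a 0] is never used. *)
Definition convergent (R : realType) (a : nat -> nat) (j : nat) : R :=
  contfrac R [seq a i | i <- iota 1 j].

Definition is_contfrac (R : realType) (a : nat -> nat) (alpha : R) : Prop :=
  (forall i, (0 < i)%N -> (0 < a i)%N) /\
  (convergent R a @ \oo --> alpha).

(* Denominator q_j of the j-th convergent in lowest terms, see [convergentE]
   and [coprime_cf_num_den]. *)
Fixpoint cf_den (a : nat -> nat) (j : nat) : nat :=
  match j with
  | 0 => 1
  | 1 => a 1
  | (j'.+1 as j1).+1 => a j * cf_den a j1 + cf_den a j'
  end.

Fixpoint cf_num (a : nat -> nat) (j : nat) : nat :=
  match j with
  | 0 => 0
  | 1 => 1
  | (j'.+1 as j1).+1 => a j * cf_num a j1 + cf_num a j'
  end.

Definition recip_sum (R : realType) (alpha : R) (M : nat) : R :=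
  \sum_(1 <= m < M.+1) (dist_int (m%:R * alpha))^-1.

Lemma dist_intP (R : realType) (x : R) :
  (exists n : int, dist_int x = `|x - n%:~R|) /\
  (forall n : int, dist_int x <= `|x - n%:~R|).
Proof.
set E := range (fun n : int => `|x - n%:~R|).
have lbE : has_lbound E by exists 0 => _ [n _ <-].
have le_n (n : int) : dist_int x <= `|x - n%:~R|.
  by apply: ge_inf => //; exists n.
split=> //.
pose f := Num.floor x; have /andP[f1 f2] := floor_itv x.
have f2' : x < f%:~R + 1 by move: f2; rewrite intrD.
have sep (n : int) : n%:~R <= f%:~R :> R \/ f%:~R + 1 <= n%:~R :> R.
  have [lenf|ltfn] := leP n f; first by left; rewrite ler_int.
  by right; rewrite -[X in _ + X]/(1%:~R) -intrD ler_int; lia.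
have [h|h] := leP (x - f%:~R) (f%:~R + 1 - x).
- exists f; apply/eqP; rewrite eq_le le_n /=.
  apply: lb_le_inf; first by exists `|x - f%:~R|; exists f.
  move=> _ [n _ <-]; rewrite (@ger0_norm _ (x - f%:~R)); last by lra.
  have [hn|hn] := sep n.
    by rewrite ger0_norm; lra.
  by rewrite ler0_norm; lra.
- exists (f + 1); apply/eqP; rewrite eq_le le_n /=.
  apply: lb_le_inf; first by exists `|x - f%:~R|; exists f.
  move=> _ [n _ <-]; rewrite intrD (@ler0_norm _ (x - _)); last by lra.
  have [hn|hn] := sep n.
    by rewrite ger0_norm; lra.
  by rewrite ler0_norm; lra.
Qed.

Lemma cf_den_gt0 (a : nat -> nat) (j : nat) :
  (forall i, (0 < i)%N -> (0 < a i)%N) -> (0 < cf_den a j)%N.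
Proof.
move=> a0; suff: (0 < cf_den a j)%N && (0 < cf_den a j.+1)%N by case/andP.
elim: j => [|j /andP[IH1 IH2]]; first by rewrite /= a0.
rewrite IH2 /=; have := a0 j.+2 isT; move: IH1 IH2 => /=; nia.
Qed.

Lemma cf_den_ge (a : nat -> nat) (j : nat) :
  (forall i, (0 < i)%N -> (0 < a i)%N) -> (j <= cf_den a j)%N.
Proof.
move=> a0; suff: (j <= cf_den a j)%N && (j.+1 <= cf_den a j.+1)%N by case/andP.
elim: j => [|j /andP[IH1 IH2]]; first by rewrite /= a0.
rewrite IH2 /=; have := a0 j.+2 isT; have := cf_den_gt0 j a0.
move: IH1 IH2 => /=; nia.
Qed.

Lemma cf_det (R : comPzRingType) (a : nat -> nat) (j : nat) :
  (cf_num a j.+1)%:R * (cf_den a j)%:R - (cf_num a j)%:R * (cf_den a j.+1)%:R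
  = (-1) ^+ j :> R.
Proof.
elim: j => [|j IH]; first by rewrite /= expr0; ring.
rewrite exprS -IH /= !natrD !natrM; ring.
Qed.

Lemma coprime_cf_num_den (a : nat -> nat) (j : nat) :
  coprime (cf_num a j) (cf_den a j).
Proof.
rewrite /coprime -dvdn1.
have := cf_det int a j.
set g := gcdn _ _ => det.
have [gp gq] : (g %| cf_num a j)%N /\ (g %| cf_den a j)%N.
  by split; [exact: dvdn_gcdl|exact: dvdn_gcdr].
have : (g %| ((-1) ^+ j : int))%Z.
  rewrite -det; apply: rpredB; rewrite !natz.
    by apply: dvdz_mull; rewrite dvdzE.
  by apply: dvdz_mulr; rewrite dvdzE.
by rewrite dvdzE abszX /= exp1n.
Qed.

(* Finite continued fraction with a real last term x. *)
Definition contfrac_tail (R : realType) (s : seq nat) (x : R) : R :=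
  foldr (fun a y => (a%:R + y)^-1) x s.

Lemma contfrac_tailS (R : realType) (a : nat -> nat) (j : nat) (x : R) :
  contfrac_tail [seq a i | i <- iota 1 j.+1] x =
  contfrac_tail [seq a i | i <- iota 1 j] ((a j.+1)%:R + x)^-1.
Proof.
by have := iotaD 1 j 1; rewrite addn1 => ->;
  rewrite map_cat /contfrac_tail foldr_cat add1n.
Qed.

Lemma contfrac_tailE (R : realType) (a : nat -> nat) (j : nat) (x : R) :
  (forall i, (0 < i)%N -> (0 < a i)%N) -> 0 <= x ->
  contfrac_tail [seq a i | i <- iota 1 j.+1] x =
  ((cf_num a j.+1)%:R + (cf_num a j)%:R * x) /
  ((cf_den a j.+1)%:R + (cf_den a j)%:R * x).
Proof.
move=> a0; elim: j x => [|j IH] x x0.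
  by rewrite /contfrac_tail /= !mul0r mul1r addr0 mul1r.
have aj : 0 < (a j.+2)%:R :> R by rewrite ltr0n a0.
rewrite contfrac_tailS IH; last first.
  by rewrite invr_ge0 addr_ge0 // ltW.
rewrite [cf_num a j.+2]/(a j.+2 * cf_num a j.+1 + cf_num a j)%N.
rewrite [cf_den a j.+2]/(a j.+2 * cf_den a j.+1 + cf_den a j)%N.
have q1 : 0 < (cf_den a j.+1)%:R :> R by rewrite ltr0n cf_den_gt0.
have q0 : 0 < (cf_den a j)%:R :> R by rewrite ltr0n cf_den_gt0.
move: (cf_num a j.+1) (cf_num a j) (cf_den a j.+1) (cf_den a j) q1 q0.
move=> p1 p0 q1 q0 q1_gt0 q0_gt0; rewrite !natrD !natrM.
field; do ?[apply/andP; split]; apply: lt0r_neq0; nra.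
Qed.

Lemma convergentE (R : realType) (a : nat -> nat) (j : nat) :
  (forall i, (0 < i)%N -> (0 < a i)%N) ->
  convergent R a j = (cf_num a j)%:R / (cf_den a j)%:R.
Proof.
move=> a0; case: j => [|j]; first by rewrite /convergent /= mul0r.
have := @contfrac_tailE R a j 0 a0 (lexx 0); rewrite !mulr0 !addr0 => <-.
by rewrite /convergent; elim: [seq _ | _ <- _] => //= b s ->.
Qed.

(* Every irrational in [0, 1) has a continued fraction expansion. *)
Lemma is_contfrac_exists (R : realType) (alpha : R) :
  0 <= alpha < 1 -> irrational alpha -> exists a, is_contfrac a alpha.
Proof.
move=> /andP[al0 al1] irr.
pose step (t : R) := t^-1 - (Num.truncn t^-1)%:R.
pose t n := iter n step alpha.
pose a i := Num.truncn (t i.-1)^-1.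
have irr0 (x : R) : irrational x -> x != 0.
  by move=> ix; apply/eqP => x0; apply: ix; exists 0 => //; rewrite rmorph0.
have tP n : 0 < t n < 1 /\ irrational (t n).
  elim: n => [|n [/andP[tn0 tn1] itn]].
    by rewrite /t /= lt0r (irr0 _ irr) al0 al1.
  have itS : irrational (t n.+1).
    move=> [q _ qE]; apply: itn; exists (q + (Num.truncn (t n)^-1)%:R)^-1 => //.
    by rewrite fmorphV rmorphD /= qE rmorph_nat /t /= /step subrK invrK.
  split=> //; rewrite lt0r (irr0 _ itS) /=.
  have /truncn_itv/andP[] : 0 <= (t n)^-1 by rewrite invr_ge0 ltW.
  rewrite -natr1 /t /= /step; rewrite -/(t n); lra.
have a0 i : (0 < i)%N -> (0 < a i)%N.
  case: i => // i _; rewrite /a /=; have [/andP[ti0 ti1] _] := tP i.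
  by rewrite truncn_gt0 invf_ge1 // ltW.
have tail n : alpha = contfrac_tail [seq a i | i <- iota 1 n] (t n).
  elim: n => [//|n IH].
  by rewrite contfrac_tailS {1}IH /a /= /step addrC subrK invrK.
exists a; split=> //.
have err n : `|alpha - convergent R a n.+1| <= n.+1%:R^-1.
  rewrite convergentE // (tail n.+1); have [/andP[t0 t1] _] := tP n.+1.
  rewrite contfrac_tailE //; last exact: ltW.
  have q1 : 0 < (cf_den a n.+1)%:R :> R by rewrite ltr0n cf_den_gt0.
  have q0 : 0 < (cf_den a n)%:R :> R by rewrite ltr0n cf_den_gt0.
  have qn : n.+1%:R <= (cf_den a n.+1)%:R :> R by rewrite ler_nat cf_den_ge.
  have q01 : 1 <= (cf_den a n)%:R :> R by rewrite ler1n cf_den_gt0.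
  have det := cf_det R a n.
  have D0 : 0 < (cf_den a n.+1)%:R + (cf_den a n)%:R * t n.+1.
    by rewrite addr_gt0 // mulr_gt0.
  rewrite [X in `|X|](_ : _ = (-1) ^+ n.+1 * (t n.+1 /
      (((cf_den a n.+1)%:R + (cf_den a n)%:R * t n.+1) * (cf_den a n.+1)%:R))).
    rewrite normrM normrX normrN1 expr1n mul1r ger0_norm; last first.
      by rewrite divr_ge0 ?mulr_ge0 // ltW.
    apply: (@le_trans _ _ (cf_den a n.+1)%:R^-1); last first.
      by rewrite lef_pV2 ?posrE // ltr0n.
    rewrite ler_pdivrMr ?mulr_gt0 // mulrCA mulVf ?mulr1 ?gt_eqF //.
    nra.
  rewrite exprS -det; field; apply/andP; split; exact: lt0r_neq0.
apply/cvgrPdist_le => e e0; near=> n.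
have n0 : (0 < n)%N by near: n; exists 1%N.
rewrite -(prednK n0); apply: le_trans (err _) _; rewrite prednK //.
rewrite -[e]invrK lef_pV2 ?posrE ?invr_gt0 ?ltr0n //.
near: n; exists (Num.truncn e^-1).+1 => // m /= hm.
have /truncn_itv/andP[_ /ltW h] : 0 <= e^-1 by rewrite invr_ge0 ltW.
by apply: le_trans h _; rewrite ler_nat.
Unshelve. all: by end_near.
Qed.

(* Main.v *)
Require Import Defs.
From mathcomp Require Import all_boot all_order all_algebra.
From mathcomp Require Import all_classical all_reals all_analysis.
From mathcomp Require Import ring zify.
Import Order.TTheory GRing.Theory Num.Theory.
Local Open Scope ring_scope.

(** Write p/q for the k-th convergent. Since |alpha - p/q| <= 1/(q q_{k+1}),
    every m <= M < q_{k+1} satisfies |m alpha - m p/q| < 1/q, so that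
    ||m alpha|| <= (r + 1)/q where r = m p mod q. Over q consecutive values of
    m, r runs through all the residues modulo q, hence such a block contributes
    at least q (1 + 1/2 + ... + 1/q) >= q log q. There are
    floor(M/q) >= M/(2q) disjoint blocks in [1, M]. *)

Lemma contfrac_ge0 (R : realType) (s : seq nat) : 0 <= contfrac R s.
Proof. by elim: s => //= b s IH; rewrite invr_ge0 addr_ge0. Qed.

Lemma contfrac_cat (R : realType) (s t : seq nat) :
  contfrac R (s ++ t) = contfrac_tail s (contfrac R t).
Proof. by elim: s => //= b s ->. Qed.

(** Cutting the expansion after [k.+1] terms leaves a tail x >= 0, and the later convergent equals
    (p_{k+1} + p_k x)/(q_{k+1} + q_k x). By the determinant identity [cf_det] it differs from
    p_k/q_k by exactly (-1)^k / (q_k (q_{k+1} + q_k x)). *)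
Lemma convergent_sub_le (R : realType) (a : nat -> nat) (k j : nat) :
  (forall i, (0 < i)%N -> (0 < a i)%N) ->
  `|convergent R a (k.+1 + j) - (cf_num a k)%:R / (cf_den a k)%:R|
    <= ((cf_den a k)%:R * (cf_den a k.+1)%:R)^-1.
Proof.
move=> a0; rewrite /convergent iotaD map_cat contfrac_cat.
set x := contfrac R _; have x0 : 0 <= x by exact: contfrac_ge0.
rewrite contfrac_tailE //.
have q1 : 0 < (cf_den a k.+1)%:R :> R by rewrite ltr0n cf_den_gt0.
have q0 : 0 < (cf_den a k)%:R :> R by rewrite ltr0n cf_den_gt0.
have D0 : 0 < (cf_den a k.+1)%:R + (cf_den a k)%:R * x.
  by rewrite ltr_pwDl // mulr_ge0 // ltW.
rewrite [X in `|X|](_ : _ = (-1) ^+ k *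
    ((cf_den a k)%:R * ((cf_den a k.+1)%:R + (cf_den a k)%:R * x))^-1).
  rewrite normrM normrX normrN1 expr1n mul1r ger0_norm; last first.
    by rewrite invr_ge0 mulr_ge0 // ltW.
  rewrite lef_pV2 ?posrE ?mulr_gt0 // ler_pM2l // lerDl.
  by rewrite mulr_ge0 // ltW.
by rewrite -(cf_det R a k); field; rewrite !lt0r_neq0.
Qed.

(** The preceding bound is uniform in [j], so it survives the limit: a convergent within e of
    [alpha] costs only an extra e. *)
Lemma contfrac_approx (R : realType) (a : nat -> nat) (alpha : R) (k : nat) :
  is_contfrac a alpha ->
  `|alpha - (cf_num a k)%:R / (cf_den a k)%:R|
    <= ((cf_den a k)%:R * (cf_den a k.+1)%:R)^-1.
Proof.
move=> [a0 cva]; apply/ler_addgt0Pl => e e0.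
have /cvgrPdist_le /(_ e e0) [N _ HN] := cva.
have := HN (k.+1 + N)%N (leq_addl _ _) => /= h.
have h' := convergent_sub_le R a k N a0.
apply: le_trans (ler_distD (convergent R a (k.+1 + N)) _ _) _.
exact: lerD.
Qed.

(** If m alpha were an integer n, then alpha = n/m would be rational. Positivity lets upper bounds
    on the distance be inverted, since [0^-1] is 0 here. *)
Lemma dist_int_gt0 (R : realType) (alpha : R) (m : nat) :
  irrational alpha -> (0 < m)%N -> 0 < dist_int (m%:R * alpha).
Proof.
move=> irr m0; have [[n ->] _] := dist_intP (m%:R * alpha).
rewrite normr_gt0 subr_eq0; apply/eqP => h; apply: irr.
exists (n%:~R / m%:R) => //.
rewrite fmorph_div /= ratr_int ratr_nat -h mulrC mulKf //.
by rewrite pnatr_eq0 -lt0n.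
Qed.

(** The integer floor(mp/q) is used as competitor in the minimum: it leaves r/q with r = mp mod q,
    and the approximation error adds at most 1/q. *)
Lemma dist_int_le_modn (R : realType) (alpha : R) (p q m : nat) :
  (0 < q)%N -> `|m%:R * (alpha - p%:R / q%:R)| <= q%:R^-1 ->
  dist_int (m%:R * alpha) <= ((m * p) %% q).+1%:R / q%:R.
Proof.
move=> q0 h; have [_ /(_ ((m * p) %/ q)%N%:Z) le_d] := dist_intP (m%:R * alpha).
apply: le_trans le_d _.
have qR : 0 < q%:R :> R by rewrite ltr0n.
have E : m%:R * alpha - ((m * p) %/ q)%N%:Z%:~R =
    m%:R * (alpha - p%:R / q%:R) + ((m * p) %% q)%:R / q%:R :> R.
  have := divn_eq (m * p) q => /(congr1 (fun n => n%:R : R)).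
  rewrite natrD !natrM -pmulrn => {}E.
  have -> : ((m * p) %% q)%:R = m%:R * p%:R - ((m * p) %/ q)%:R * q%:R :> R.
    by rewrite E addrC addKr.
  by field; rewrite lt0r_neq0.
rewrite E; apply: le_trans (ler_normD _ _) _.
rewrite [X in _ + X]ger0_norm ?divr_ge0 //.
by rewrite -natr1 mulrDl mul1r addrC lerD2l.
Qed.

(** Induction on [q], each step using ln(1 + x) <= x at x = 1/(q+1). *)
Lemma lnS_le_harmonic (R : realType) (q : nat) :
  ln q.+1%:R <= \sum_(r < q) r.+1%:R^-1 :> R.
Proof.
elim: q => [|q IH]; first by rewrite big_ord0 ln1.
have q0 : 0 < q.+1%:R :> R by rewrite ltr0n.
have iq0 : 0 < q.+1%:R^-1 :> R by rewrite invr_gt0.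
have -> : q.+2%:R = q.+1%:R * (1 + q.+1%:R^-1) :> R.
  by rewrite mulrDr mulr1 divff ?lt0r_neq0 // natr1.
rewrite lnM ?posrE ?addr_gt0 // big_ord_recr; apply: lerD => //.
by apply: le_ln1Dx; apply: lt_trans iq0; rewrite ltrN10.
Qed.

Lemma eqn_mod_coprimeMr (p d m n : nat) : coprime d p ->
  (m * p == n * p %[mod d])%N = (m == n %[mod d])%N.
Proof.
move=> cdp; wlog le_nm : m n / (n <= m)%N => [W|].
  have [|/ltnW] := leqP n m; first exact: W.
  by rewrite eq_sym [RHS]eq_sym; exact: W.
by rewrite !eqn_mod_dvd // ?leq_mul2r ?le_nm ?orbT // -mulnBl Gauss_dvdl.
Qed.

(** As p is invertible modulo q, the map i -> (s + i) p mod q is injective on ['I_q], hence a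
    permutation that reindexes the sum. *)
Lemma sum_modn_shift (V : nmodType) (F : nat -> V) (p q s : nat) :
  (0 < q)%N -> coprime p q ->
  \sum_(i < q) F (((s + i) * p) %% q)%N = \sum_(r < q) F r.
Proof.
case: q => // q _ cpq.
pose f (i : 'I_q.+1) : 'I_q.+1 := inord (((s + i) * p) %% q.+1).
have fE i : f i = (((s + i) * p) %% q.+1)%N :> nat.
  by rewrite inordK // ltn_mod.
have f_inj : injective f.
  move=> i j /(congr1 val) /=; rewrite !fE => /eqP.
  rewrite eqn_mod_coprimeMr; last by rewrite coprime_sym.
  by rewrite eqn_modDl !modn_small // => /eqP /val_inj.
rewrite [RHS](reindex_inj f_inj) /=.
by apply: eq_bigr => i _; rewrite fE.
Qed.

Lemma block_recip_sum (R : realType) (alpha : R) (p q s : nat) :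
  irrational alpha -> (0 < q)%N -> (0 < s)%N -> coprime p q ->
  (forall m, (s <= m < s + q)%N ->
     `|m%:R * (alpha - p%:R / q%:R)| <= q%:R^-1) ->
  q%:R * ln q%:R <= \sum_(s <= m < s + q) (dist_int (m%:R * alpha))^-1.
Proof.
move=> irr q0 s0 cpq h.
have qR : 0 < q%:R :> R by rewrite ltr0n.
rewrite -[X in \sum_(X <= _ < _) _]add0n big_addn addKn big_mkord.
have lnq : ln q%:R <= ln q.+1%:R :> R.
  by rewrite ler_ln ?posrE ?ltr0n // ler_nat.
apply: le_trans (ler_wpM2l (ltW qR) (le_trans lnq (lnS_le_harmonic R q))) _.
rewrite -(sum_modn_shift _ (fun r => r.+1%:R^-1) p q s) // mulr_sumr.
apply: ler_sum => i _; rewrite [(i + s)%N]addnC.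
have d0 : 0 < dist_int ((s + i)%:R * alpha).
  by apply: dist_int_gt0 => //; rewrite addn_gt0 s0.
(* Termwise, q/(r+1) <= 1/||m alpha|| is inverted into ||m alpha|| <= (r+1)/q. *)
rewrite -[q%:R * _]invrK lef_pV2 ?posrE // ?invr_gt0 ?divr_gt0 ?ltr0n //.
rewrite invfM invrK [leRHS]mulrC.
by apply: dist_int_le_modn => //; apply: h; rewrite leq_addr ltn_add2l ltn_ord.
Qed.

Lemma blocks_recip_sum (R : realType) (alpha : R) (p q B : nat) :
  irrational alpha -> (0 < q)%N -> coprime p q ->
  (forall m, (m <= B * q)%N -> `|m%:R * (alpha - p%:R / q%:R)| <= q%:R^-1) ->
  B%:R * (q%:R * ln q%:R) <= recip_sum alpha (B * q).
Proof.
move=> irr q0 cpq; rewrite /recip_sum; elim: B => [|B IH] h.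
  by rewrite mul0r big_geq.
rewrite (big_cat_nat (n := (B * q).+1)) //=; last first.
  by rewrite ltnS leq_mul2r leqnSn orbT.
rewrite -natr1 mulrDl mul1r; apply: lerD.
  by apply: IH => m hm; apply: h; rewrite mulSn; lia.
(* The last block starts at Bq + 1, so every block avoids m = 0. *)
have -> : (B.+1 * q).+1 = ((B * q).+1 + q)%N by rewrite mulSn; lia.
by apply: block_recip_sum (cpq) _ => // m hm; apply: h; rewrite mulSn; lia.
Qed.

Theorem theorem3p1 (R : realType) :
  exists c : R, 0 < c /\
    forall (alpha : R) (a : nat -> nat) (M k : nat),
      0 <= alpha < 1 -> irrational alpha -> is_contfrac a alpha ->
      (0 < M)%N ->
      (cf_den a k <= M < cf_den a k.+1)%N ->
      c * M%:R * ln (cf_den a k)%:R <= recip_sum alpha M.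
Proof.
exists 2^-1; split; first by rewrite invr_gt0.
move=> alpha a M k _ irr cfa M0 /andP[qM Mq].
have q0 : (0 < cf_den a k)%N by apply: cf_den_gt0; case: cfa.
have q1 : (0 < cf_den a k.+1)%N by apply: cf_den_gt0; case: cfa.
have := contfrac_approx R a alpha k cfa.
have := coprime_cf_num_den a k.
move: (cf_num a k) (cf_den a k) (cf_den a k.+1) q0 q1 qM Mq => p q Q.
move=> q0 Q0 qM MQ cpq appr.
have qR : 0 < q%:R :> R by rewrite ltr0n.
have QR : 0 < Q%:R :> R by rewrite ltr0n.
have BM : (M %/ q * q <= M)%N by exact: leq_trunc_div.
(* The incomplete block at the end has nonnegative terms and is dropped. *)
apply: (@le_trans _ _ (recip_sum alpha (M %/ q * q))); last first.
  rewrite /recip_sum [leRHS](big_cat_nat (n := (M %/ q * q).+1)) //= lerDl.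
  rewrite big_nat_cond; apply: sumr_ge0 => m /andP[/andP[m0 _] _].
  by rewrite invr_ge0 ltW // dist_int_gt0 // (leq_ltn_trans _ m0).
apply: le_trans (blocks_recip_sum R alpha p q (M %/ q) irr q0 cpq _).
  (* The constant 1/2 comes from M <= 2 floor(M/q) q: the quotient is at least 1 because q <= M, and
     the remainder is below q. *)
  rewrite mulrA ler_wpM2r ?ln_ge0 ?ler1n // ler_pdivrMl // -!natrM ler_nat.
  have := divn_eq M q; have := ltn_pmod M q0.
  have : (0 < M %/ q)%N by rewrite divn_gt0.
  nia.
(* Since m <= M < Q, the error m/(qQ) is at most 1/q. *)
move=> m mB; rewrite normrM normr_nat.
apply: le_trans (ler_wpM2l (ler0n _ _) appr) _.
rewrite invfM mulrCA ler_piMr ?invr_ge0 ?ler0n // ler_pdivrMr // mul1r ler_nat.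
exact: leq_trans mB (leq_trans BM (ltnW MQ)).
Qed.
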